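(* Let $S$ be a semigroup, $\sigma:S\to S$ an involutive automorphism and $\mu$ a discrete measure on $S$. The solutions $f,g:S\to\mathbb{C}$ of the integral Kannappan-sine subtraction law $$\int_{S}f(x\sigma(y)t)\,d\mu(t)=f(x)g(y)-f(y)g(x)\quad\text{for all }x,y\in S$$ are exactly the pairs $(f,g)$ of the following forms. (1) $f=0$ and $g$ is arbitrary. (2) $f$ is any non-zero function such that $\int_{S}f(xyt)\,d\mu(t)=0$ for all $x,y\in S$, and $g=kf$, where $k\in\mathbb{C}$ is a constant. (3) There exist constants $\gamma,b\in\mathbb{C}^{*}$, $c\in\mathbb{C}\setminus\{\pm1\}$ and an exponential $\chi$ on $S$ with $\chi\neq\chi\circ\sigma$, $\int_{S}\chi(t)\,d\mu(t)=\dfrac{-2b}{1+c}$ and $\int_{S}\chi\circ\sigma(t)\,d\mu(t)=\dfrac{2b}{1-c}$ such that $$f=\frac{\chi+\chi\circ\sigma}{2\gamma}+c\,\frac{\chi-\chi\circ\sigma}{2\gamma}\quad\text{and}\quad g=b(\chi-\chi\circ\sigma).$$ (4) There exist constants $\beta,b\in\mathbb{C}^{*}$, $c\in\mathbb{C}$ and an exponential $\chi$ on $S$ with $\chi\neq\chi\circ\sigma$ and $\int_{S}\chi(t)\,d\mu(t)=\int_{S}\chi\circ\sigma(t)\,d\mu(t)=1/\beta$ such that $$f=b(\chi-\chi\circ\sigma)\quad\text{and}\quad g=\frac{\chi+\chi\circ\sigma}{2\beta}+c\,\frac{\chi-\chi\circ\sigma}{2\beta}.$$ (5) There exist constants $\alpha,\delta,b\in\mathbb{C}^{*}$,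 $c\in\mathbb{C}$ and an exponential $\chi$ on $S$ with $\alpha\neq\pm(2b\delta+\alpha c)$, $\chi\neq\chi\circ\sigma$, $\int_{S}\chi(t)\,d\mu(t)=\dfrac{2b}{\alpha(1+c)+2b\delta}$ and $\int_{S}\chi\circ\sigma(t)\,d\mu(t)=\dfrac{2b}{\alpha(c-1)+2b\delta}$ such that $$f=\alpha\,\frac{\chi+\chi\circ\sigma}{2\delta}+(\alpha c+2b\delta)\frac{\chi-\chi\circ\sigma}{2\delta}\quad\text{and}\quad g=\frac{\chi+\chi\circ\sigma}{2\delta}+c\,\frac{\chi-\chi\circ\sigma}{2\delta}.$$ (6) There exist a constant $\gamma\in\mathbb{C}^{*}$, an exponential $\chi$ on $S$ and a non-zero function $\phi_\chi:S\to\mathbb{C}$ satisfying $\phi_\chi(xy)=\phi_\chi(x)\chi(y)+\chi(x)\phi_\chi(y)$ for all $x,y\in S$, with $\chi\circ\sigma=\chi$, $\phi_\chi\circ\sigma=-\phi_\chi$, $\int_S\chi(t)\,d\mu(t)\neq0$ and $\int_S\phi_\chi(t)\,d\mu(t)=\left(\int_S\chi(t)\,d\mu(t)\right)^2$ such that $$f=\frac1\gamma\left(\chi-\frac{1}{\int_S\chi(t)\,d\mu(t)}\phi_\chi\right)\quad\text{and}\quad g=\phi_\chi.$$ (7) There exist constants $\alpha,c\in\mathbb{C}$ and $\delta\in\mathbb{C}^{*}$, an exponential $\chi$ on $S$ and a non-zero function $\phi_\chi:S\to\mathbb{C}$ satisfying $\phi_\chi(xy)=\phi_\chi(x)\chi(y)+\chi(x)\phi_\chi(y)$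 for all $x,y\in S$, with $\alpha c+\delta\neq0$, $\chi\circ\sigma=\chi$, $\phi_\chi\circ\sigma=-\phi_\chi$, $\int_S\chi(t)\,d\mu(t)=\dfrac{1}{\alpha c+\delta}$ and $\int_S\phi_\chi(t)\,d\mu(t)=\dfrac{-\alpha}{(\alpha c+\delta)^2}$ such that $$f=\frac1\delta\left[\alpha\chi+(\alpha c+\delta)\phi_\chi\right]\quad\text{and}\quad g=\frac1\delta\left(\chi+c\,\phi_\chi\right).$$ (8) There exist a constant $c\in\mathbb{C}$, an exponential $\chi$ on $S$ and a non-zero function $\phi_\chi:S\to\mathbb{C}$ satisfying $\phi_\chi(xy)=\phi_\chi(x)\chi(y)+\chi(x)\phi_\chi(y)$ for all $x,y\in S$, with $\chi\circ\sigma=\chi$, $\phi_\chi\circ\sigma=-\phi_\chi$, $\int_S\chi(t)\,d\mu(t)\neq0$ and $\int_S\phi_\chi(t)\,d\mu(t)=0$ such that $$f=\phi_\chi\quad\text{and}\quad g=\left(\int_S\chi(t)\,d\mu(t)\right)(\chi+c\,\phi_\chi).$$ Moreover, if $S$ is a topological semigroup and $f,g\in C(S)$, then $\chi,\chi\circ\sigma\in C(S)$ and $\phi_\chi\in C(S)$ (for whichever of these functions occur in the form of $(f,g)$).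
   Context: A semigroup is a set with an associative composition rule. An involutive automorphism of $S$ is a map $\sigma:S\to S$ with $\sigma(xy)=\sigma(x)\sigma(y)$ and $\sigma(\sigma(x))=x$ for all $x,y\in S$. A discrete measure on $S$ is a measure of the form $\mu=\sum_{i\in I}\alpha_i\delta_{z_i}$ with $\alpha_i\in\mathbb{C}$ and $z_i\in S$, where $\delta_{z}$ is the Dirac measure at $z$; thus $\int_S h(t)\,d\mu(t)=\sum_{i\in I}\alpha_i h(z_i)$. A function $\chi:S\to\mathbb{C}$ is multiplicative if $\chi(xy)=\chi(x)\chi(y)$ for all $x,y\in S$; an exponential is a multiplicative function with $\chi\neq0$ (not identically zero). $\mathbb{C}^{*}=\mathbb{C}\setminus\{0\}$. If $S$ is a topological semigroup, $C(S)$ denotes the algebra of continuous functions from $S$ to $\mathbb{C}$. *)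

(* Defs.v *)
From HB Require Import structures.
From mathcomp Require Import all_boot all_order all_algebra finmap.
From mathcomp Require Import boolp classical_sets functions reals.
From mathcomp Require Import topology normedtype.
From mathcomp Require Import complex.
From mathcomp.analysis.showcase Require Import summability.

Set Implicit Arguments.
Unset Strict Implicit.
Unset Printing Implicit Defensive.

Import Order.TTheory GRing.Theory Num.Theory.
Import numFieldNormedType.Exports.

Local Open Scope classical_set_scope.
Local Open Scope ring_scope.
Local Open Scope complex_scope.

HB.instance Definition _ (R : realType) :=
  NormedModule.copy R[i] (R[i] : numFieldType).

HB.mixin Record isTopologicalSemigroup S of Topological S & Semigroup S := {
  mulg_continuous : continuous (fun p : S * S => (p.1 * p.2)%g)
}.

#[short(type="topologicalSemigroupType")]
HB.structure Definition TopologicalSemigroup :=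
  {S of isTopologicalSemigroup S & Topological S & Semigroup S}.

Definition involutive_automorphism (S : semigroupType) (sigma : S -> S) : Prop :=
  {morph sigma : x y / (x * y)%g} /\ involutive sigma.

(* The measure [\sum_(i : I) alpha_i delta_(z_i)]; the index set [I] may be
   infinite. *)
Record discrete_measure (R : realType) (S : Type) := DiscreteMeasure {
  dm_index : choiceType;
  dm_weight : dm_index -> R[i];
  dm_point : dm_index -> S
}.

(* [is_dint mu h v]: the family [alpha_i * h (z_i)] is (unconditionally)
   summable with sum [v].  Since an arbitrary [h] need not be integrable when
   the index set is infinite, the integral is a relation; when the index set is
   finite it always exists and is the finite sum, see [is_dint_fin]. *)
Definition is_dint (R : realType) (S : Type) (mu : discrete_measure R S)
    (h : S -> R[i]) (v : R[i]) : Prop :=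
  partial_sum (fun i => dm_weight i * h (dm_point (d := mu) i)) @ totally
    --> v.

Lemma is_dint_fin (R : realType) (S : Type) (I : finType) (alpha : I -> R[i])
    (z : I -> S) (h : S -> R[i]) (v : R[i]) :
  is_dint (DiscreteMeasure alpha z) h v <-> v = \sum_i alpha i * h (z i).
Proof.
pose u i := alpha i * h (z i).
have cv : partial_sum u @ totally --> \sum_i u i.
  apply: cvg_near_cst; first exact: totally_filter.
  exists [fset i in enum I]%fset => // A /= /fsubsetP sA.
  rewrite /partial_sum -(big_seq_fsetE _ _ xpredT u) /=.
  have pA : perm_eq A (index_enum I).
    apply: uniq_perm; rewrite ?fset_uniq ?index_enum_uniq // => i.
    by rewrite mem_index_enum sA // inE mem_enum.
  by rewrite (perm_big _ pA).
split=> [|->]; last exact: cv.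
have H : hausdorff_space R[i] by exact: norm_hausdorff.
move=> hv; exact: (cvg_unique H (FF := fmap_proper_filter _ totally_filter) hv cv).
Qed.

Section Equation.
Variables (R : realType) (S : semigroupType).
Variables (sigma : S -> S) (mu : discrete_measure R S).
Local Notation C := R[i].
Implicit Types f g chi phi : S -> C.

Definition kannappan_sine_subtraction f g : Prop :=
  forall x y : S,
    is_dint mu (fun t => f (x * sigma y * t)%g) (f x * g y - f y * g x).

Definition multiplicative_fun chi : Prop :=
  forall x y : S, chi (x * y)%g = chi x * chi y.

Definition exponential chi : Prop := multiplicative_fun chi /\ chi <> cst 0.

Definition sine_additive chi phi : Prop :=
  forall x y : S, phi (x * y)%g = phi x * chi y + chi x * phi y.

Definition solution1 f g : Prop := f = cst 0.

Definition solution2 f g : Prop :=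
  [/\ f <> cst 0,
      forall x y : S, is_dint mu (fun t => f (x * y * t)%g) 0
    & exists k : C, g = (fun x => k * f x)].

Definition solution3 f g chi : Prop :=
  exists gamma b c : C,
    [/\ gamma != 0, b != 0, c != 1 & c != -1] /\
    [/\ exponential chi, chi <> chi \o sigma,
        is_dint mu chi (- 2 * b / (1 + c))
      & is_dint mu (chi \o sigma) (2 * b / (1 - c))] /\
    f = (fun x => (chi x + chi (sigma x)) / (2 * gamma)
                  + c * ((chi x - chi (sigma x)) / (2 * gamma))) /\
    g = (fun x => b * (chi x - chi (sigma x))).

Definition solution4 f g chi : Prop :=
  exists beta b c : C,
    [/\ beta != 0 & b != 0] /\
    [/\ exponential chi, chi <> chi \o sigma,
        is_dint mu chi (1 / beta) & is_dint mu (chi \o sigma) (1 / beta)] /\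
    f = (fun x => b * (chi x - chi (sigma x))) /\
    g = (fun x => (chi x + chi (sigma x)) / (2 * beta)
                  + c * ((chi x - chi (sigma x)) / (2 * beta))).

Definition solution5 f g chi : Prop :=
  exists alpha delta b c : C,
    [/\ alpha != 0, delta != 0, b != 0,
        alpha != 2 * b * delta + alpha * c
      & alpha != - (2 * b * delta + alpha * c)] /\
    [/\ exponential chi, chi <> chi \o sigma,
        is_dint mu chi (2 * b / (alpha * (1 + c) + 2 * b * delta))
      & is_dint mu (chi \o sigma)
          (2 * b / (alpha * (c - 1) + 2 * b * delta))] /\
    f = (fun x => alpha * ((chi x + chi (sigma x)) / (2 * delta))
                  + (alpha * c + 2 * b * delta)
                    * ((chi x - chi (sigma x)) / (2 * delta))) /\
    g = (fun x => (chi x + chi (sigma x)) / (2 * delta)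
                  + c * ((chi x - chi (sigma x)) / (2 * delta))).

Definition solution6 f g chi phi : Prop :=
  exists gamma m : C,
    gamma != 0 /\
    [/\ exponential chi, phi <> cst 0 & sine_additive chi phi] /\
    [/\ chi \o sigma = chi, phi \o sigma = (fun x => - phi x),
        is_dint mu chi m, m != 0 & is_dint mu phi (m ^+ 2)] /\
    f = (fun x => 1 / gamma * (chi x - 1 / m * phi x)) /\
    g = phi.

Definition solution7 f g chi phi : Prop :=
  exists alpha c delta : C,
    [/\ delta != 0 & alpha * c + delta != 0] /\
    [/\ exponential chi, phi <> cst 0 & sine_additive chi phi] /\
    [/\ chi \o sigma = chi, phi \o sigma = (fun x => - phi x),
        is_dint mu chi (1 / (alpha * c + delta))
      & is_dint mu phi (- alpha / (alpha * c + delta) ^+ 2)] /\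
    f = (fun x => 1 / delta * (alpha * chi x + (alpha * c + delta) * phi x)) /\
    g = (fun x => 1 / delta * (chi x + c * phi x)).

Definition solution8 f g chi phi : Prop :=
  exists c m : C,
    [/\ exponential chi, phi <> cst 0 & sine_additive chi phi] /\
    [/\ chi \o sigma = chi, phi \o sigma = (fun x => - phi x),
        is_dint mu chi m, m != 0 & is_dint mu phi 0] /\
    f = phi /\
    g = (fun x => m * (chi x + c * phi x)).

End Equation.

(* Main.v *)
Require Import Defs.
From HB Require Import structures.
From mathcomp Require Import all_boot all_order all_algebra ring.
From mathcomp Require Import boolp classical_sets functions reals.
From mathcomp Require Import topology normedtype.
From mathcomp Require Import complex.
From mathcomp.analysis.showcase Require Import summability.
Import Order.TTheory GRing.Theory Num.Theory.
Import numFieldNormedType.Exports.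
Local Open Scope classical_set_scope.
Local Open Scope ring_scope.
Local Open Scope complex_scope.

(** The integral disappears from the equation as soon as it is evaluated at a
triple product.  Write [x, y] = f(x)g(y) - f(y)g(x).  Since sigma is a
morphism, x sigma(yz) t and (x sigma(y)) sigma(z) t are the same point, so
uniqueness of the integral gives the purely algebraic identity
            [x sigma(y), z] = [x, yz],
called [twisted] below.  If f and g are proportional this says nothing, and the
solutions are forms (1) and (2).  Otherwise V = span(f, g) is a plane and the
identity determines it.

The identity expresses f(x sigma(y)) and g(x sigma(y)) through f(x) and g(x),
so V is stable under right translations ([translate_span]); expanding f(yz)
and g(yz) as well shows that left translation by y is the adjugate, trace minus
identity, of right translation by sigma(y), that is,
h(yz) + h(z sigma(y)) = tau(y) h(z) for h in V ([wilson]).  A left and a right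
translation always commute, hence so do any two right translations
([translate_comm]), and commuting operators on a complex plane have a common
eigenvector q, q(xy) = chi(y) q(x) ([common_eigenfunction]).

The bracket changes by a determinant under a change of basis, so the identity
can be read in a basis (p, q) of V.  Either chi = 0, and then every h in V
vanishes on triple products, which makes the integral vanish and is
incompatible with [.,.] being nonzero; or q is a multiple of chi, and comparing
coefficients of p and q shows that V is spanned either by chi and chi o sigma,
or, when chi = chi o sigma, by chi and an odd function phi with
phi(xy) = phi(x)chi(y) + chi(x)phi(y) ([twisted_solution]).

Substituting back, the equation becomes a linear system for the integrals of
chi and chi o sigma (or phi) with linearly independent coefficient functions of
(x, y); it can be solved, so these functions are integrable separately and
their integrals are determined ([kannappan_free2]).  With f = a chi + b psi,
g = c chi + d psi this gives the two normal forms [exponential_form] and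
[sine_form]; the listed forms (3)-(5) and (6)-(8) are reparametrisations of
them, according to which of a + b, c + d, c vanish.  Continuity holds because
chi and psi are linear combinations of f and g. *)

(** * Pairs of linearly independent functions *)

Section Bracket.
Context {F : fieldType} {T : Type}.
Implicit Types p q r s : T -> F.

Definition bracket p q x y := p x * q y - p y * q x.

Definition free2 p q := exists x y, bracket p q x y != 0.

(** The two coefficients are isolated by Cramer's rule at a pair of points where
the bracket is nonzero. *)
Lemma free2_coef {p q} : free2 p q ->
  forall u w, (forall x, u * p x + w * q x = 0) -> u = 0 /\ w = 0.
Proof.
move=> [a [b nz]] u w uw.
have Eu : u * bracket p q a b = 0.
  transitivity ((u * p a + w * q a) * q b - (u * p b + w * q b) * q a).
    by rewrite /bracket; ring.
  by rewrite !uw; ring.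
have Ew : w * bracket p q a b = 0.
  transitivity ((u * p b + w * q b) * p a - (u * p a + w * q a) * p b).
    by rewrite /bracket; ring.
  by rewrite !uw; ring.
by split; apply: (mulIf nz); rewrite mul0r.
Qed.

(** If all brackets vanish, q(y) p - p(y) q = 0 is a relation for each y. *)
Lemma coef_free2 {p q} :
  (forall u w, (forall x, u * p x + w * q x = 0) -> u = 0 /\ w = 0) ->
  free2 p q.
Proof.
move=> H; apply: contrapT => nf.
have br0 x y : p x * q y - p y * q x = 0.
  by apply/eqP/negPn/negP => n; apply: nf; exists x, y.
have pq0 y : q y = 0 /\ - p y = 0.
  by apply: H => x; rewrite -(br0 x y); ring.
have [|/eqP] := H 1 0; last by rewrite oner_eq0.
move=> x; have [-> /eqP] := pq0 x.
by rewrite oppr_eq0 => /eqP ->; ring.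
Qed.

Lemma free2_neq0 {p q} : free2 p q -> exists x, q x != 0.
Proof.
move=> [a [b nz]]; apply: contrapT => nq.
have q0 x : q x = 0 by apply/eqP/negPn/negP => n; apply: nq; exists x.
by move: nz; rewrite /bracket !q0 !mulr0 subrr eqxx.
Qed.

Lemma bracketC p q x y : bracket p q x y = - bracket q p x y.
Proof. by rewrite /bracket; ring. Qed.

Lemma free2_sym {p q} : free2 p q -> free2 q p.
Proof.
by move=> [a [b nz]]; exists a, b; rewrite bracketC oppr_eq0.
Qed.

Lemma bracket_change {p q r s : T -> F} {a b c d : F} :
    (forall x, p x = a * r x + b * s x) ->
    (forall x, q x = c * r x + d * s x) ->
  forall x y, bracket p q x y = (a * d - b * c) * bracket r s x y.
Proof. by move=> Ep Eq x y; rewrite /bracket !Ep !Eq; ring. Qed.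

Lemma free2_change {p q r s : T -> F} {a b c d : F} :
    (forall x, p x = a * r x + b * s x) ->
    (forall x, q x = c * r x + d * s x) ->
  free2 p q -> a * d - b * c != 0 /\ free2 r s.
Proof.
move=> Ep Eq [x [y]]; rewrite (bracket_change Ep Eq) mulf_eq0 negb_or.
by move=> /andP[-> ?]; split=> //; exists x, y.
Qed.

Lemma not_free2 {p q} : ~ free2 p q -> p <> (fun=> 0) ->
  exists k, q = (fun x => k * p x).
Proof.
move=> nf np.
have [a pa] : exists a, p a != 0.
  apply: contrapT => H; apply: np; apply/funext => a.
  by apply/eqP/negPn/negP => n; apply: H; exists a.
exists (q a / p a); apply/funext => x; apply: (mulIf pa).
rewrite mulrAC divfK //.
apply/eqP; rewrite -subr_eq0; apply/negPn/negP => n; apply: nf; exists a, x.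
by move: n; rewrite /bracket; congr (_ != 0); ring.
Qed.

End Bracket.

(** * Common zeros of proportional binary quadratic forms *)

Lemma binary_quadratic_root {F : numClosedFieldType} (a b c : F) :
  exists u w : F,
    (u != 0) || (w != 0) /\ a * u ^+ 2 + b * u * w + c * w ^+ 2 = 0.
Proof.
have [->|a0] := eqVneq a 0; first by
  exists 1, 0; rewrite oner_neq0; split=> //; ring.
exists (- b + sqrtC (b ^+ 2 - 4 * a * c)), (2 * a).
rewrite mulf_neq0 ?pnatr_eq0 // orbT; split=> //.
have := sqrtCK (b ^+ 2 - 4 * a * c); set r := sqrtC _ => Er.
transitivity (a * (r ^+ 2 - (b ^+ 2 - 4 * a * c))); first by ring.
by rewrite Er subrr mulr0.
Qed.

(** The hypotheses say that the forms are pairwise proportional, so a zero of one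
nonzero form is a zero of all. *)
Lemma common_quadratic_root {F : numClosedFieldType} {T : Type}
    (a b c : T -> F) :
    (forall y z, a y * b z = a z * b y) ->
    (forall y z, a y * c z = a z * c y) ->
    (forall y z, b y * c z = b z * c y) ->
  exists u w : F, (u != 0) || (w != 0) /\
    forall y, a y * u ^+ 2 + b y * u * w + c y * w ^+ 2 = 0.
Proof.
move=> ab ac bc.
have [[y0 n0]|none] := pselect (exists y, [|| a y != 0, b y != 0 | c y != 0]).
  have [u [w [uw E]]] := binary_quadratic_root (a y0) (b y0) (c y0).
  exists u, w; split=> // y.
  have [n|[n|n]] : a y0 != 0 \/ b y0 != 0 \/ c y0 != 0.
  - by case/or3P: n0; tauto.
  - apply: (mulfI n); rewrite mulr0.
    transitivity (a y * (a y0 * u ^+ 2 + b y0 * u * w + c y0 * w ^+ 2)).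
      by rewrite !mulrDr !mulrA ab ac; ring.
    by rewrite E mulr0.
  - apply: (mulfI n); rewrite mulr0.
    transitivity (b y * (a y0 * u ^+ 2 + b y0 * u * w + c y0 * w ^+ 2)).
      by rewrite !mulrDr !mulrA bc [b y0 * a y]mulrC ab; ring.
    by rewrite E mulr0.
  - apply: (mulfI n); rewrite mulr0.
    transitivity (c y * (a y0 * u ^+ 2 + b y0 * u * w + c y0 * w ^+ 2)).
      by rewrite !mulrDr !mulrA [c y0 * a y]mulrC ac [c y0 * b y]mulrC bc; ring.
    by rewrite E mulr0.
exists 1, 0; rewrite oner_neq0; split=> // y.
have -> : a y = 0.
  by apply/eqP/negPn/negP => n; apply: none; exists y; rewrite n.
by ring.
Qed.

(** * The bracket identity *)

Section Twisted.
Context {F : numClosedFieldType} {S : semigroupType} {sigma : S -> S}.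
Hypothesis sigma_inv : involutive_automorphism sigma.
Implicit Types (p q chi phi : S -> F) (x y z : S).

Definition twisted p q := forall x y z,
  bracket p q (x * sigma y)%g z = bracket p q x (y * z)%g.

Let sK : involutive sigma. Proof. by case: sigma_inv. Qed.
Let sM : {morph sigma : x y / (x * y)%g}. Proof. by case: sigma_inv. Qed.

Lemma twisted_sym {p q} : twisted p q -> twisted q p.
Proof.
by move=> tw x y z; rewrite (bracketC q p) tw -bracketC.
Qed.

Lemma twisted_change {p q r s : S -> F} {a b c d : F} :
    (forall x, p x = a * r x + b * s x) ->
    (forall x, q x = c * r x + d * s x) ->
  free2 p q -> twisted p q -> twisted r s.
Proof.
move=> Ep Eq fr tw x y z; have [nz _] := free2_change Ep Eq fr.
by apply: (mulfI nz); rewrite -!(bracket_change Ep Eq).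
Qed.

(** A vector (p(z), q(z)) is determined by its brackets with two fixed points a, b,
and the brackets of x y with a and b are those of x with sigma(y) a and
sigma(y) b, which are linear in (p(x), q(x)). *)
Lemma translate_span {p q} : free2 p q -> twisted p q ->
  exists A B : S -> F, forall x y, p (x * y)%g = A y * p x + B y * q x.
Proof.
move=> [a [b nz]] tw; set D := bracket p q a b in nz.
exists (fun y => (q (sigma y * b)%g * p a - q (sigma y * a)%g * p b) / D).
exists (fun y => (p (sigma y * a)%g * p b - p (sigma y * b)%g * p a) / D).
move=> x y; apply: (mulIf nz).
have := tw x (sigma y) a; have := tw x (sigma y) b; rewrite sK => Eb Ea.
transitivity (bracket p q (x * y)%g b * p a - bracket p q (x * y)%g a * p b).
  by rewrite /D /bracket; ring.
by rewrite Eb Ea /bracket; field.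
Qed.

(** For a plane, a map M and its adjugate M' satisfy M + M' = tr(M); here M is the
right translation by sigma(y) and M' the left translation by y, and the
explicit value of tau is that trace. *)
Lemma wilson {p q} : free2 p q -> twisted p q ->
  exists tau : S -> F, forall y z,
    p (y * z)%g + p (z * sigma y)%g = tau y * p z /\
    q (y * z)%g + q (z * sigma y)%g = tau y * q z.
Proof.
move=> [a [b nz]] tw; set D := bracket p q a b in nz.
exists (fun y => (bracket p q a (y * b)%g + bracket p q (y * a)%g b) / D).
move=> y z.
suff W h : h = p \/ h = q -> h (y * z)%g + h (z * sigma y)%g =
    (bracket p q a (y * b)%g + bracket p q (y * a)%g b) / D * h z.
  by split; apply: W; [left|right].
move=> hpq.
have expand x : h x * D = bracket p q x b * h a - bracket p q x a * h b.
  by case: hpq => ->; rewrite /D /bracket; ring.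
have left_translate x : bracket p q x (y * z)%g * D =
    bracket p q x (y * b)%g * bracket p q a z
    - bracket p q x (y * a)%g * bracket p q b z.
  by rewrite -!tw /D /bracket; ring.
have Ea := left_translate a; have Eb := left_translate b.
apply: (mulIf nz); rewrite mulrAC divfK // mulrDl !expand !tw.
apply: (mulIf nz); rewrite mulrDl.
have -> : (bracket p q (y * z)%g b * h a - bracket p q (y * z)%g a * h b) * D =
    bracket p q a (y * z)%g * D * h b - bracket p q b (y * z)%g * D * h a.
  by rewrite /bracket; ring.
by rewrite Ea Eb; case: hpq => ->; rewrite /D /bracket; ring.
Qed.

(** Evaluate [wilson] at sigma(y) in two ways: at the product x z, and at x after a
right translation by z.  Both give p(sigma(y)xz) plus one of the two sides. *)
Lemma translate_comm {p q} : free2 p q -> twisted p q ->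
  forall x y z, p (x * y * z)%g = p (x * z * y)%g.
Proof.
move=> fr tw x y z; have [tau W] := wilson fr tw.
have [A [B AB]] := translate_span fr tw.
have [Wp Wq] := W (sigma y) x; have [Wp' _] := W (sigma y) (x * z)%g.
rewrite sK in Wp Wq Wp'.
apply: (addrI (p (sigma y * x * z)%g)).
rewrite -[in RHS](mulgA (sigma y)) Wp' !(AB _ z).
transitivity (A z * (p (sigma y * x)%g + p (x * y)%g)
  + B z * (q (sigma y * x)%g + q (x * y)%g)); first by ring.
by rewrite Wp Wq; ring.
Qed.
(** With right translation by y acting as p -> A p + B q, q -> C p + D q, the
combination u p + w q is an eigenfunction iff B u^2 + (D - A) u w - C w^2 = 0,
and these forms are proportional because the translations commute. *)
Lemma common_eigenfunction {p q} : free2 p q -> twisted p q ->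
  exists (u w : F) chi, (u != 0) || (w != 0) /\
    forall x y, u * p (x * y)%g + w * q (x * y)%g
                = chi y * (u * p x + w * q x).
Proof.
move=> fr tw; have frs := free2_sym fr; have tws := twisted_sym tw.
have [A [B AB]] := translate_span fr tw.
have [D [C DC]] := translate_span frs tws.
have cp y z : A z * A y + B z * C y - (A y * A z + B y * C z) = 0 /\
    A z * B y + B z * D y - (A y * B z + B y * D z) = 0.
  apply: (free2_coef fr) => x; have := translate_comm fr tw x y z.
  by rewrite !AB !DC => /eqP; rewrite -subr_eq0 => /eqP <-; ring.
have cq y z : D z * C y + C z * A y - (D y * C z + C y * A z) = 0 /\
    D z * D y + C z * B y - (D y * D z + C y * B z) = 0.
  apply: (free2_coef fr) => x; have := translate_comm frs tws x y z.
  by rewrite !DC !AB => /eqP; rewrite -subr_eq0 => /eqP <-; ring.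
have [|||u [w [uw Q]]] := @common_quadratic_root F S B (fun y => D y - A y)
    (fun y => - C y).
- move=> y z; have [_ /eqP E] := cp y z; apply/eqP; rewrite -subr_eq0 -oppr_eq0.
  by rewrite -(eqP E); apply/eqP; ring.
- move=> y z; have [/eqP E _] := cp y z; apply/eqP; rewrite -subr_eq0.
  by rewrite -(eqP E); apply/eqP; ring.
- move=> y z; have [/eqP E _] := cq y z; apply/eqP; rewrite -subr_eq0.
  by rewrite -(eqP E); apply/eqP; ring.
have [u0|u0] := eqVneq u 0.
  move: uw Q; rewrite u0 eqxx /= => w0 Q; exists 0, w, D.
  rewrite w0 orbT; split=> // x y; rewrite DC.
  have -> : C y = 0.
    apply/eqP; have /eqP := Q y; rewrite expr0n !mulr0 mul0r !add0r mulNr.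
    by rewrite oppr_eq0 mulf_eq0 expf_eq0 /= (negPf w0) orbF.
  by ring.
exists u, w, (fun y => (u * A y + w * C y) / u); split; first by rewrite u0.
move=> x y; rewrite AB DC; apply: (mulIf u0); apply/eqP.
rewrite -subr_eq0 [X in X == _](_ : _ =
  (B y * u ^+ 2 + (D y - A y) * u * w + - C y * w ^+ 2) * q x).
  by rewrite Q mul0r.
by field.
Qed.

Lemma triangular_basis {f g : S -> F} : free2 f g -> twisted f g ->
  exists p q chi (a b c d : F),
    [/\ forall x, f x = a * p x + b * q x, forall x, g x = c * p x + d * q x
      & forall x y, q (x * y)%g = chi y * q x].
Proof.
move=> fr tw; have [u [w [chi [uw E]]]] := common_eigenfunction fr tw.
have [w0|w0] := eqVneq w 0.
  have u0 : u != 0 by move: uw; rewrite w0 eqxx orbF.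
  exists g, (fun x => u * f x + w * g x), chi, 0, u^-1, 1, 0.
  by split=> //= x; rewrite w0; field.
exists f, (fun x => u * f x + w * g x), chi, 1, 0, (- u / w), w^-1.
by split=> //= x; field.
Qed.

(** The bracket identity in a triangular basis: the left-hand sides are the
coefficients of p(x) and q(x). *)
Lemma twisted_coef {p q chi A B} : free2 p q -> twisted p q ->
    (forall x y, q (x * y)%g = chi y * q x) ->
    (forall x y, p (x * y)%g = A y * p x + B y * q x) ->
  forall y z, A (sigma y) * q z - chi z * q y = 0 /\
    B (sigma y) * q z - chi (sigma y) * p z + A z * p y + B z * q y = 0.
Proof.
move=> fr tw qM pM y z; apply: (free2_coef fr) => x.
have := tw x y z; rewrite /bracket !pM !qM => /eqP.
by rewrite -subr_eq0 => /eqP <-; ring.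
Qed.

(** The coefficient of p reads A(sigma(y)) q(z) = chi(z) q(y).  If chi = 0 it
forces A = 0, so translations are nilpotent; otherwise separating the
variables gives first that q is a multiple of A o sigma and then that
A o sigma = chi. *)
Lemma eigen_dichotomy {p q chi} : free2 p q -> twisted p q ->
    (forall x y, q (x * y)%g = chi y * q x) ->
  (forall x y z, p (x * y * z)%g = 0 /\ q (x * y * z)%g = 0) \/
  (forall x y, chi (x * y)%g = chi x * chi y) /\
    exists2 k, k != 0 & forall x, q x = k * chi x.
Proof.
move=> fr tw qM; have [A [B pM]] := translate_span fr tw.
have K := twisted_coef fr tw qM pM; have [x0 q0] := free2_neq0 fr.
have [[z1 c1]|none] := pselect (exists z, chi z != 0); last first.
  have chi0 z : chi z = 0 by apply/eqP/negPn/negP => n; apply: none; exists z.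
  left=> x y z; have A0 : A z = 0.
    have [/eqP + _] := K (sigma z) x0; rewrite sK chi0 mul0r subr0 mulf_eq0.
    by rewrite (negPf q0) orbF => /eqP.
  by rewrite pM !qM A0 !chi0; split; ring.
right; split=> [x y|].
  by apply: (mulIf q0); rewrite -qM mulgA !qM; ring.
have qA y : chi z1 * q y = A (sigma y) * q z1.
  by have [/eqP + _] := K y z1; rewrite subr_eq0 => /eqP.
have qz1 : q z1 != 0.
  have := mulf_neq0 c1 q0; rewrite qA; apply: contraNneq => ->.
  by rewrite mulr0.
exists (q z1 / chi z1) => [|x]; first by rewrite mulf_neq0 ?invr_eq0.
have Ax : A (sigma x) = chi x.
  have nA : A (sigma x0) != 0.
    have := mulf_neq0 c1 q0; rewrite qA; apply: contraNneq => ->.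
    by rewrite mul0r.
  have [/eqP + _] := K x0 x; rewrite subr_eq0 => /eqP E.
  apply: (mulfI (mulf_neq0 nA qz1)).
  transitivity (A (sigma x0) * (A (sigma x) * q z1)); first by ring.
  rewrite -qA mulrCA E.
  transitivity (chi x * (chi z1 * q x0)); first by ring.
  by rewrite qA; ring.
by apply: (mulfI c1); rewrite qA Ax; field.
Qed.

(** Here p(xy) = chi(sigma(y)) p(x) + B(y) chi(x), and the coefficient equation E
relates B and p.  Its symmetric part shows that B is odd under sigma.
Associativity gives B(yz) = chi(sigma(z)) B(y) + chi(y) B(z); if chi is even
this is the sine addition law for phi = B, and if not, comparing it with its
image under sigma forces B to be a multiple of chi - chi o sigma.  In both
cases E then yields p. *)
Lemma second_basis_function {p chi} : free2 p chi -> twisted p chi ->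
    (forall x y, chi (x * y)%g = chi x * chi y) ->
  (chi <> chi \o sigma /\
    exists c k, forall x, p x = c * chi x + k * chi (sigma x)) \/
  (chi \o sigma = chi /\ exists phi k,
    [/\ forall x y, phi (x * y)%g = phi x * chi y + chi x * phi y,
        phi \o sigma = (fun x => - phi x)
      & forall x, p x = 1 * phi x + k * chi x]).
Proof.
move=> fr tw cM.
have cM' x y : chi (x * y)%g = chi y * chi x by rewrite cM mulrC.
have [A [B pM]] := translate_span fr tw.
have K := twisted_coef fr tw cM' pM; have [z0 nz0] := free2_neq0 fr.
have AE y : A y = chi (sigma y).
  have [/eqP + _] := K (sigma y) z0.
  rewrite sK [chi z0 * _]mulrC -mulrBl mulf_eq0 (negPf nz0) orbF subr_eq0.
  by move/eqP.
have E y z : B (sigma y) * chi z - chi (sigma y) * p z + chi (sigma z) * p y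
    + B z * chi y = 0 by have [_] := K y z; rewrite AE.
have H y z : (B y + B (sigma y)) * chi z + (B z + B (sigma z)) * chi y = 0.
  by rewrite -[RHS](addr0 0) -{1}(E y z) -(E z y); ring.
have Bodd y : B (sigma y) = - B y.
  (* the symmetric part at (z0, z0) reads 2 (B + B o sigma)(z0) chi(z0) = 0 *)
  have H0 : B z0 + B (sigma z0) = 0.
    apply: (mulIf nz0); apply: (mulfI (_ : 2 != 0)); first by rewrite pnatr_eq0.
    by rewrite mul0r mulr0 -(H z0 z0); ring.
  apply/eqP; rewrite -addr_eq0 addrC; apply/eqP; apply: (mulIf nz0).
  by rewrite mul0r -(H y z0) H0; ring.
have BM y z : B (y * z)%g = chi (sigma z) * B y + chi y * B z.
  apply: (mulIf nz0); apply: (addrI (chi (sigma (y * z)) * p z0)).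
  by rewrite -AE -pM mulgA !pM !AE !cM sM cM; ring.
have [cs|cs] := pselect (chi = chi \o sigma); last left.
  right; split=> //; have cE x : chi (sigma x) = chi x by rewrite [in RHS]cs.
  exists B, ((p z0 - B z0) / chi z0); split=> [x y||x].
  - by rewrite BM cE; ring.
  - by apply/funext => x; exact: Bodd.
  apply: (mulIf nz0); apply/eqP; rewrite -subr_eq0 -(E x z0) Bodd !cE.
  by apply/eqP; field.
split=> //.
have [y0 ny0] : exists y, chi y - chi (sigma y) != 0.
  apply: contrapT => none; apply: cs; apply/funext => y /=; apply/eqP.
  by rewrite -subr_eq0; apply/negPn/negP => n; apply: none; exists y.
(* B(yz) against - B(sigma(yz)) *)
have sym y z : (chi (sigma z) - chi z) * B y = (chi (sigma y) - chi y) * B z.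
  have := Bodd (y * z)%g; rewrite sM !BM !sK !Bodd => /eqP.
  rewrite -subr_eq0 => /eqP e; apply/eqP; rewrite -subr_eq0 -e.
  by apply/eqP; ring.
pose c := B y0 / (chi y0 - chi (sigma y0)).
have BE z : B z = c * (chi z - chi (sigma z)).
  apply: (mulfI ny0); have := sym y0 z => /(congr1 -%R); rewrite -!mulNr !opprB.
  by move=> <-; rewrite /c; field.
exists c, ((p (sigma z0) - c * chi (sigma z0)) / chi z0) => x.
apply: (mulfI nz0); apply/eqP; rewrite -subr_eq0 -(E x (sigma z0)) Bodd !BE !sK.
by apply/eqP; field.
Qed.

Lemma twisted_solution {f g : S -> F} : free2 f g -> twisted f g ->
  [\/ forall x y z, f (x * y * z)%g = 0,
      exists chi a b c d,
        [/\ forall x y, chi (x * y)%g = chi x * chi y, chi <> chi \o sigma,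
           forall x, f x = a * chi x + b * chi (sigma x)
         & forall x, g x = c * chi x + d * chi (sigma x)]
    | exists chi phi a b c d,
        [/\ forall x y, chi (x * y)%g = chi x * chi y, chi \o sigma = chi,
           forall x y, phi (x * y)%g = phi x * chi y + chi x * phi y,
           phi \o sigma = (fun x => - phi x)
         & (forall x, f x = a * chi x + b * phi x) /\
           (forall x, g x = c * chi x + d * phi x)]].
Proof.
move=> fr tw.
have [p [q [chi [a [b [c [d [fE gE qM]]]]]]]] := triangular_basis fr tw.
have [_ fr'] := free2_change fE gE fr; have tw' := twisted_change fE gE fr tw.
have [z0|[cM [k k0 qE]]] := eigen_dichotomy fr' tw' qM.
  by apply: Or31 => x y z; rewrite fE; have [-> ->] := z0 x y z; ring.
have pE x : p x = 1 * p x + 0 * chi x by ring.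
have qE' x : q x = 0 * p x + k * chi x by rewrite qE; ring.
have [_ fr''] := free2_change pE qE' fr'.
have tw'' := twisted_change pE qE' fr' tw'.
have [[cs [c' [k' pE']]]|[cs [phi [k' [phM phs pE']]]]] :=
  second_basis_function fr'' tw'' cM.
  apply: Or32; exists chi.
  exists (a * c' + b * k), (a * k'), (c * c' + d * k), (c * k').
  by split=> // x; rewrite (fE, gE) qE pE'; ring.
apply: Or33; exists chi, phi, (a * k' + b * k), a, (c * k' + d * k), c.
by split=> //; split=> x; rewrite (fE, gE) qE pE'; ring.
Qed.
End Twisted.

(** * Integration against a discrete measure *)

Lemma cvg_lin {K : numFieldType} {T} {F : set_system T} {FF : Filter F}
    (h k : T -> K) (u v a b : K) : h @ F --> u -> k @ F --> v ->
  (fun x => a * h x + b * k x) @ F --> a * u + b * v.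
Proof. by move=> hu kv; apply: cvgD; apply: cvgMl_tmp. Qed.

Section Integral.
Context {R : realType} {S : Type} {mu : discrete_measure R S}.
Local Notation C := R[i].
Implicit Types (h k : S -> C) (u v a b : C).

Lemma is_dint_unique {h u v} : is_dint mu h u -> is_dint mu h v -> u = v.
Proof.
have H : hausdorff_space R[i] by exact: norm_hausdorff.
exact: (cvg_unique H (FF := fmap_proper_filter _ totally_filter)).
Qed.

Lemma is_dint_lin {h k u v} a b : is_dint mu h u -> is_dint mu k v ->
  is_dint mu (fun t => a * h t + b * k t) (a * u + b * v).
Proof.
rewrite /is_dint => hu kv.
pose ph A := partial_sum (fun i => dm_weight i * h (dm_point (d := mu) i)) A.
pose pk A := partial_sum (fun i => dm_weight i * k (dm_point (d := mu) i)) A.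
rewrite (_ : partial_sum _ = (fun A => a * ph A + b * pk A)); last first.
  apply/funext => A; rewrite /ph /pk /partial_sum !mulr_sumr -big_split /=.
  by apply: eq_bigr => i _; ring.
exact: (@cvg_lin R[i] _ totally totally_filter ph pk u v a b hu kv).
Qed.

Lemma is_dint_eq {h k u v} : is_dint mu h u -> (forall t, h t = k t) -> u = v ->
  is_dint mu k v.
Proof. by move=> I /funext <- <-. Qed.

Lemma is_dint_val {h u v} : is_dint mu h u -> u = v -> is_dint mu h v.
Proof. by move=> I <-. Qed.

Lemma is_dint0 : is_dint mu (fun=> 0) 0.
Proof.
rewrite /is_dint (_ : partial_sum _ = (fun=> 0)); last first.
  by apply/funext => A; rewrite /partial_sum big1 // => i _; rewrite mulr0.
exact: (@cvg_cst R[i] 0 _ totally totally_filter).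
Qed.

Lemma is_dintZ {h u} a : is_dint mu h u ->
  is_dint mu (fun t => a * h t) (a * u).
Proof.
move=> hu; by apply: (is_dint_eq (is_dint_lin a 0 hu hu)) => [t|]; ring.
Qed.

Lemma is_dint_inv {h u a} : a != 0 -> is_dint mu (fun t => a * h t) u ->
  is_dint mu h (u / a).
Proof.
move=> a0 hu; apply: (is_dint_eq (is_dintZ a^-1 hu)) => [t|]; last exact: mulrC.
exact: mulKf.
Qed.

(** Two values of s where the coefficient vectors (P s, Q s) are independent allow
solving for h and k, which gives their integrability and not only the values. *)
Lemma is_dint_free2 {T : Type} {P Q : T -> C} {h k u v} : free2 P Q ->
    (forall s,
      is_dint mu (fun t => P s * h t + Q s * k t) (P s * u + Q s * v)) ->
  is_dint mu h u /\ is_dint mu k v.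
Proof.
move=> [x [y nz]] I; set D := bracket P Q x y in nz; split.
  apply: (is_dint_eq (is_dint_lin (Q y / D) (- (Q x / D)) (I x) (I y))) => [t|];
    by rewrite /D /bracket; field.
apply: (is_dint_eq (is_dint_lin (- (P y / D)) (P x / D) (I x) (I y))) => [t|];
  by rewrite /D /bracket; field.
Qed.
End Integral.

(** * Normal forms of the nondegenerate solutions *)

Section Forms.
Context {R : realType} {S : semigroupType} (sigma : S -> S)
  (mu : discrete_measure R S).
Local Notation C := R[i].
Implicit Types f g chi phi : S -> C.

(** Forms (3), (4) and (5) at once: a * d - b * c is the factor relating the
brackets of (f, g) and (chi, chi o sigma), and the equation amounts to
a I(chi) = a d - b c and b I(chi o sigma) = - (a d - b c). *)
Definition exponential_form f g chi : Prop := exists a b c d : C,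
  [/\ a != 0, b != 0 & a * d - b * c != 0] /\
  [/\ exponential chi, chi <> chi \o sigma,
      is_dint mu chi ((a * d - b * c) / a)
    & is_dint mu (chi \o sigma) (- (a * d - b * c) / b)] /\
  f = (fun x => a * chi x + b * chi (sigma x)) /\
  g = (fun x => c * chi x + d * chi (sigma x)).

(** Forms (6), (7) and (8) at once, without a normalisation of phi: the equation
amounts to b I(chi) = - (a d - b c) and a I(chi) + b I(phi) = 0. *)
Definition sine_form f g chi phi : Prop := exists a b c d : C,
  (b != 0 /\ a * d - b * c != 0) /\
  [/\ exponential chi, phi <> cst 0 & sine_additive chi phi] /\
  [/\ chi \o sigma = chi, phi \o sigma = (fun x => - phi x),
      is_dint mu chi (- (a * d - b * c) / b)
    & is_dint mu phi (a * (a * d - b * c) / b ^+ 2)] /\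
  f = (fun x => a * chi x + b * phi x) /\
  g = (fun x => c * chi x + d * phi x).

End Forms.

Section FormTheory.
Context {R : realType} {S : semigroupType} {sigma : S -> S}
  {mu : discrete_measure R S}.
Local Notation C := R[i].
Implicit Types f g chi phi : S -> C.

(** Form (3) is the case c + d = 0, form (4) the case c + d != 0 = a + b, and form
(5) the remaining one.  They never vanish together because
a d - b c = a (c + d) - c (a + b). *)
Lemma exponential_formP {f g chi} :
  exponential_form sigma mu f g chi <->
  solution3 sigma mu f g chi \/ solution4 sigma mu f g chi \/
  solution5 sigma mu f g chi.
Proof.
have n2 : 2 != 0 :> C by rewrite pnatr_eq0.
split=> [[a [b [c [d [[a0 b0 e0] [[ex ne Ia Ib] [fE gE]]]]]]]|].
  have [cd0|cd0] := eqVneq (c + d) 0.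
    have dE : d = - c by apply/eqP; rewrite -addr_eq0 addrC cd0.
    have : a * d - b * c = - c * (a + b) by rewrite dE; ring.
    move=> e; move: (e0); rewrite e mulf_eq0 negb_or oppr_eq0 => /andP[c0 ab0].
    left; exists (a + b)^-1, c, ((a - b) / (a + b)).
    split; first split.
    - by rewrite invr_eq0.
    - exact: c0.
    - rewrite -subr_eq0 [X in X != 0](_ : _ = - 2 * b / (a + b)); last by field.
      by rewrite !mulf_neq0 ?invr_eq0 ?oppr_eq0.
    - rewrite -subr_eq0 opprK.
      rewrite [X in X != 0](_ : _ = 2 * a / (a + b)); last by field.
      by rewrite !mulf_neq0 ?invr_eq0.
    have e1 : 1 + (a - b) / (a + b) = 2 * a / (a + b) by field.
    have e2 : 1 - (a - b) / (a + b) = 2 * b / (a + b) by field.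
    rewrite e1 e2; split; first (split; [exact: ex|exact: ne| |]).
    - by apply: (is_dint_val Ia); rewrite e; field; rewrite ?a0 ?ab0.
    - by apply: (is_dint_val Ib); rewrite e; field; rewrite ?b0 ?ab0.
    split; apply/funext => x; rewrite ?fE ?gE ?dE; last by ring.
    by field; rewrite ?n2.
  have [ab0|ab0] := eqVneq (a + b) 0.
    have bE : b = - a by apply/eqP; rewrite -addr_eq0 addrC ab0.
    right; left; exists (c + d)^-1, a, ((c - d) / (c + d)).
    split; first by rewrite invr_eq0.
    split; first (split; [exact: ex|exact: ne| |]).
    - by apply: (is_dint_val Ia); rewrite bE; field; rewrite ?a0 ?cd0.
    - by apply: (is_dint_val Ib); rewrite bE; field; rewrite ?cd0 ?oppr_eq0 ?a0.
    split; apply/funext => x; rewrite ?fE ?gE ?bE; first by ring.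
    by field; rewrite ?n2.
  right; right.
  exists ((a + b) / (c + d)), (c + d)^-1, ((a * d - b * c) / (c + d)), 
    ((c - d) / (c + d)).
  split; first split.
  - by rewrite mulf_neq0 ?invr_eq0.
  - by rewrite invr_eq0.
  - by rewrite mulf_neq0 ?invr_eq0.
  - rewrite -subr_eq0 [X in X != 0](_ : _ = 2 * b / (c + d)); last by field.
    by rewrite !mulf_neq0 ?invr_eq0.
  - rewrite -subr_eq0 [X in X != 0](_ : _ = 2 * a / (c + d)); last by field.
    by rewrite !mulf_neq0 ?invr_eq0.
  split; first (split; [exact: ex|exact: ne| |]).
  - rewrite [X in _ / X](_ : _ = 2 * a / (c + d)); last by field.
    by apply: (is_dint_val Ia); field; rewrite ?a0 ?cd0.
  - rewrite [X in _ / X](_ : _ = - 2 * b / (c + d)); last by field.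
    by apply: (is_dint_val Ib); field; rewrite ?b0 ?cd0.
  by split; apply/funext => x; rewrite ?fE ?gE; field; rewrite ?n2 ?cd0.
case=> [|[]].
- move=> [ga [b [c [[ga0 b0 c1 c2] [[ex ne I1 I2] [-> ->]]]]]].
  have p1 : 1 + c != 0 by rewrite addrC -[1]opprK subr_eq0.
  have p2 : 1 - c != 0 by rewrite subr_eq0 eq_sym.
  exists ((1 + c) / (2 * ga)), ((1 - c) / (2 * ga)), b, (- b).
  have e : (1 + c) / (2 * ga) * - b - (1 - c) / (2 * ga) * b = - b / ga.
    by field; rewrite ?n2 ?ga0.
  rewrite e; split; first by rewrite !mulf_neq0 ?invr_eq0 ?mulf_neq0 ?oppr_eq0.
  split; first (split; [exact: ex|exact: ne| |]).
  - by apply: (is_dint_val I1); field; rewrite ?n2 ?ga0 ?p1.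
  - by apply: (is_dint_val I2); field; rewrite ?n2 ?ga0 ?p2.
  by split; apply/funext => x; field; rewrite ?n2 ?ga0.
- move=> [be [b [c [[be0 b0] [[ex ne I1 I2] [-> ->]]]]]].
  exists b, (- b), ((1 + c) / (2 * be)), ((1 - c) / (2 * be)).
  have e : b * ((1 - c) / (2 * be)) - - b * ((1 + c) / (2 * be)) = b / be.
    by field; rewrite ?n2 ?be0.
  rewrite e; split; first by rewrite !mulf_neq0 ?invr_eq0 ?oppr_eq0.
  split; first (split; [exact: ex|exact: ne| |]).
  - by apply: (is_dint_val I1); field; rewrite ?be0 ?b0.
  - by apply: (is_dint_val I2); field; rewrite ?be0 ?b0.
  by split; apply/funext => x; field; rewrite ?n2 ?be0.
move=> [al [de [b [c [[al0 de0 b0 n1 n3] [[ex ne I1 I2] [-> ->]]]]]]].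
have p1 : al * (1 + c) + 2 * b * de != 0.
  by move: n3; rewrite -subr_eq0; congr (_ != 0); ring.
have p2 : al * (c - 1) + 2 * b * de != 0.
  by move: n1; rewrite eq_sym -subr_eq0; congr (_ != 0); ring.
exists ((al * (1 + c) + 2 * b * de) / (2 * de)),
  (- (al * (c - 1) + 2 * b * de) / (2 * de)),
  ((1 + c) / (2 * de)), ((1 - c) / (2 * de)).
have e : (al * (1 + c) + 2 * b * de) / (2 * de) * ((1 - c) / (2 * de)) -
    - (al * (c - 1) + 2 * b * de) / (2 * de) * ((1 + c) / (2 * de)) = b / de.
  by field; rewrite ?n2 ?de0.
rewrite e.
split; first by rewrite !mulf_neq0 ?invr_eq0 ?oppr_eq0 ?mulf_neq0.
split; first (split; [exact: ex|exact: ne| |]).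
- by apply: (is_dint_val I1); field; rewrite ?n2 ?de0 ?p1.
- by apply: (is_dint_val I2); field; rewrite ?n2 ?de0 ?p2.
by split; apply/funext => x; field; rewrite ?n2 ?de0.
Qed.

Lemma sine_additive_scale {s chi phi} : s != 0 ->
  [/\ exponential chi, phi <> cst 0 & sine_additive chi phi] ->
  phi \o sigma = (fun x => - phi x) ->
  let psi := fun x => s * phi x in
  [/\ exponential chi, psi <> cst 0 & sine_additive chi psi] /\
  psi \o sigma = (fun x => - psi x).
Proof.
move=> s0 [ex nz ad] odd /=; split; first split=> //.
- move=> /funeqP z; apply: nz; apply/funext => x; apply: (mulfI s0).
  by rewrite z /= mulr0.
- by move=> x y; rewrite ad; ring.
by apply/funext => x /=; have /funeqP/(_ x) /= -> := odd; ring.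
Qed.

(** Rescaling phi reaches form (6) if c = 0 and form (7) if not; form (8) is form
(7) with alpha = 0, up to such a rescaling. *)
Lemma sine_form_solution {f g chi phi} : sine_form sigma mu f g chi phi ->
  exists psi, solution6 sigma mu f g chi psi \/ solution7 sigma mu f g chi psi.
Proof.
move=> [a [b [c [d [[b0 e0] [H [[cs ps Ic Ip] [fE gE]]]]]]]].
have [c0|c0] := eqVneq c 0.
  move: (e0); rewrite c0 mulr0 subr0 mulf_eq0 negb_or => /andP[a0 d0].
  have [H' ps'] := sine_additive_scale d0 H ps.
  exists (fun x => d * phi x); left; exists a^-1, (- (a * d) / b).
  split; first by rewrite invr_eq0.
  split; [exact: H'|split; last first].
    by split; apply/funext => x; rewrite ?fE ?gE ?c0;
      field; rewrite ?a0 ?d0 ?b0.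
  split; [exact: cs|exact: ps'| | |].
  - by apply: (is_dint_val Ic); rewrite c0 mulr0 subr0.
  - by rewrite !mulf_neq0 ?invr_eq0 ?oppr_eq0 ?mulf_neq0.
  - by apply: (is_dint_val (is_dintZ d Ip)); rewrite c0; field.
have s0 : - (a * d - b * c) / c != 0 by rewrite mulf_neq0 ?invr_eq0 ?oppr_eq0.
have [H' ps'] := sine_additive_scale s0 H ps.
exists (fun x => - (a * d - b * c) / c * phi x); right.
exists (a / c), (- d / (a * d - b * c)), c^-1.
rewrite (_ : a / c * (- d / (a * d - b * c)) + c^-1 = - b / (a * d - b * c));
  last by field; rewrite ?c0 ?e0.
split; first by rewrite !mulf_neq0 ?invr_eq0 ?oppr_eq0 ?mulf_neq0.
split; [exact: H'|split; last first].
  by split; apply/funext => x; rewrite ?fE ?gE; field; rewrite ?c0 ?e0 ?b0.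
split; [exact: cs|exact: ps'| |].
- by apply: (is_dint_val Ic); field; rewrite ?e0 ?oppr_eq0 ?b0.
- apply: (is_dint_val (is_dintZ (- (a * d - b * c) / c) Ip)).
  by field; rewrite ?e0 ?b0 ?c0 ?oppr_eq0 ?b0.
Qed.

Lemma solution_sine_form {f g chi phi} :
  solution6 sigma mu f g chi phi \/ solution7 sigma mu f g chi phi \/
  solution8 sigma mu f g chi phi -> sine_form sigma mu f g chi phi.
Proof.
case=> [|[]].
- move=> [ga [m [ga0 [H [[cs ps Ic m0 Ip] [-> ->]]]]]].
  exists (1 / ga), (- (1 / (ga * m))), 0, 1.
  split; first split.
  - by rewrite oppr_eq0 mulf_neq0 ?oner_eq0 ?invr_eq0 ?mulf_neq0.
  - by rewrite mulr1 mulr0 subr0 mulf_neq0 ?oner_eq0 ?invr_eq0.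
  split; first exact: H.
  split; last by split; apply/funext => x; field; rewrite ?ga0 ?m0.
  split; [exact: cs|exact: ps| |].
  - by apply: (is_dint_val Ic); field; rewrite ?m0 ?ga0 ?oppr_eq0 ?oner_eq0.
  - by apply: (is_dint_val Ip); field; rewrite ?m0 ?ga0 ?oppr_eq0 ?oner_eq0.
- move=> [al [c [de [[de0 n0] [H [[cs ps Ic Ip] [-> ->]]]]]]].
  exists (al / de), ((al * c + de) / de), (1 / de), (c / de).
  rewrite (_ : al / de * (c / de) - (al * c + de) / de * (1 / de) = - (1 / de));
    last by field.
  split; first split.
  - by rewrite mulf_neq0 ?invr_eq0.
  - by rewrite oppr_eq0 mulf_neq0 ?oner_eq0 ?invr_eq0.
  split; first exact: H.
  split; last by split; apply/funext => x; field; rewrite ?de0.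
  split; [exact: cs|exact: ps| |].
  - by apply: (is_dint_val Ic); field; rewrite ?n0 ?de0.
  - by apply: (is_dint_val Ip); field; rewrite ?n0 ?de0.
move=> [c [m [H [[cs ps Ic m0 Ip] [-> ->]]]]].
exists 0, 1, m, (m * c).
rewrite mul0r mul1r sub0r.
split; first by rewrite oner_eq0 oppr_eq0.
split; [exact: H|split; last by split; apply/funext => x; ring].
split; [exact: cs|exact: ps| |].
- by apply: (is_dint_val Ic); field; rewrite ?oner_eq0.
- by apply: (is_dint_val Ip); field; rewrite ?oner_eq0.
Qed.

Hypothesis sigma_inv : involutive_automorphism sigma.

Lemma exponential_form_kannappan {f g chi} :
  exponential_form sigma mu f g chi -> kannappan_sine_subtraction sigma mu f g.
Proof.
have [sM sK] := sigma_inv.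
move=> [a [b [c [d [[a0 b0 _] [[[cM _] _ Ia Ib] [-> ->]]]]]]] x y.
apply: (is_dint_eq (is_dint_lin (a * chi x * chi (sigma y))
    (b * chi (sigma x) * chi y) Ia Ib)) => [t /=|].
  by rewrite !sM sK !cM; ring.
by field; rewrite ?a0 ?b0.
Qed.

Lemma sine_form_kannappan {f g chi phi} :
  sine_form sigma mu f g chi phi -> kannappan_sine_subtraction sigma mu f g.
Proof.
move=> [a [b [c [d [[b0 _] [[[cM _] _ ad] [[cs ps Ic Ip] [-> ->]]]]]]]] x y.
have csE z : chi (sigma z) = chi z by rewrite -[in RHS]cs.
have psE z : phi (sigma z) = - phi z by have /funeqP/(_ z) := ps.
apply: (is_dint_eq (is_dint_lin
  (a * chi x * chi y + b * (phi x * chi y - chi x * phi y)) (b * chi x * chi y)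
  Ic Ip)) => [t /=|]; last by field; rewrite ?b0.
by rewrite !ad !cM csE psE; ring.
Qed.

(** Both sides are the integral of t |-> f(x sigma(y) sigma(z) t). *)
Lemma kannappan_twisted {f g} : kannappan_sine_subtraction sigma mu f g ->
  twisted (sigma := sigma) f g.
Proof.
have [sM sK] := sigma_inv => K x y z.
have := K x (y * z)%g; rewrite sM mulgA.
move/(is_dint_unique (K (x * sigma y)%g z)).
by rewrite /bracket => ->.
Qed.

(** The three outcomes of [twisted_solution]: the first makes the integrals vanish
against a nonzero bracket; in the others the coefficient functions of (x, y) are
independent because chi and its partner are. *)
Lemma kannappan_free2 {f g} : kannappan_sine_subtraction sigma mu f g ->
    free2 f g ->
  (exists chi, exponential_form sigma mu f g chi) \/
  (exists chi phi, sine_form sigma mu f g chi phi).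
Proof.
have [sM sK] := sigma_inv => K fr; have tw := kannappan_twisted K.
have [z0|[chi [a [b [c [d [cM cs fE gE]]]]]]|] :=
  twisted_solution sigma_inv fr tw.
- have [x [y]] := fr; rewrite /bracket => /negP[]; apply/eqP.
  apply: is_dint_unique (K x y) _.
  by apply: (is_dint_eq is_dint0) => // t; rewrite z0.
- left; exists chi; have [e0 fr'] := free2_change fE gE fr.
  have [x0 n0] := free2_neq0 (free2_sym fr'); have [x1 n1] := free2_neq0 fr'.
  have fr2 : free2 (fun s : S * S => chi s.1 * chi (sigma s.2))
                   (fun s => chi (sigma s.1) * chi s.2).
    apply: coef_free2 => u w uw.
    have [|+ _] := free2_coef fr' (u * chi (sigma x1)) (w * chi x1).
      by move=> x; rewrite -(uw (x, x1)) /=; ring.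
    have [|_ +] := free2_coef fr' (u * chi (sigma x0)) (w * chi x0).
      by move=> x; rewrite -(uw (x, x0)) /=; ring.
    move=> /eqP + /eqP; rewrite !mulf_eq0 (negPf n0) (negPf n1) !orbF.
    by move=> /eqP-> /eqP->.
  have [|Ia Ib] := is_dint_free2 (mu := mu) (h := fun t => a * chi t)
      (k := fun t => b * chi (sigma t)) (u := a * d - b * c)
      (v := - (a * d - b * c)) fr2.
    move=> [x y]; apply: (is_dint_eq (K x y)) => [t|].
      by rewrite fE !sM sK !cM /=; ring.
    by rewrite !fE !gE /=; ring.
  (* a zero coefficient would make a nonzero integral vanish *)
  have nz h k u : is_dint mu (fun t => k * h t) u -> u != 0 -> k != 0.
    move=> I; apply: contraNneq => k0; apply/eqP; apply: is_dint_unique I _.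
    by apply: (is_dint_eq is_dint0) => [t|//]; rewrite k0 mul0r.
  have a0 := nz _ _ _ Ia e0; have b0 : b != 0.
    by apply: nz Ib _; rewrite oppr_eq0.
  exists a, b, c, d; split; first by [].
  split; last by split; apply/funext.
  split; [|exact: cs|exact: is_dint_inv a0 Ia|exact: is_dint_inv b0 Ib].
  by split=> //; move=> z; move: n0; rewrite z eqxx.
move=> [chi [phi [a [b [c [d [cM cs phM ps [fE gE]]]]]]]].
right; exists chi, phi; have [e0 fr'] := free2_change fE gE fr.
have [x0 n0] := free2_neq0 (free2_sym fr'); have [x1 n1] := free2_neq0 fr'.
have csE z : chi (sigma z) = chi z by rewrite -[in RHS]cs.
have psE z : phi (sigma z) = - phi z by have /funeqP/(_ z) := ps.
have fr2 : free2 (fun s : S * S => chi s.1 * chi s.2)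
                 (fun s => phi s.1 * chi s.2 - chi s.1 * phi s.2).
  apply: coef_free2 => u w uw.
  have [|/eqP + /eqP] := free2_coef fr' (u * chi x0 - w * phi x0) (w * chi x0).
    by move=> x; rewrite -(uw (x, x0)) /=; ring.
  rewrite mulf_eq0 (negPf n0) orbF => + /eqP w0.
  by rewrite w0 mul0r subr0 mulf_eq0 (negPf n0) orbF => /eqP.
(* t |-> f(x sigma(y) t) is chi(x)chi(y) f plus a multiple of b chi *)
have [|Ia Ib] := is_dint_free2 (mu := mu) (h := f)
    (k := fun t => b * chi t) (u := 0)
    (v := - (a * d - b * c)) fr2.
  move=> [x y]; apply: (is_dint_eq (K x y)) => [t|].
    by rewrite !fE !phM !cM csE psE /=; ring.
  by rewrite !fE !gE /=; ring.
have b0 : b != 0.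
  apply/negP => /eqP b0; move: e0; rewrite -oppr_eq0 => /negP[]; apply/eqP.
  apply: is_dint_unique Ib _.
  by apply: (is_dint_eq is_dint0) => [t|//]; rewrite b0 mul0r.
have Ic := is_dint_inv b0 Ib.
exists a, b, c, d; split; first by [].
split; last first.
  split; last by split; apply/funext.
  split; [exact: cs|exact: ps|exact: Ic|].
  apply: (is_dint_eq (is_dint_lin b^-1 (- (a / b)) Ia Ic)) => [t|].
    by rewrite fE; field.
  by field.
split; [|by move=> z; move: n1; rewrite z eqxx|exact: phM].
by split=> //; move=> z; move: n0; rewrite z eqxx.
Qed.
End FormTheory.

(** * Continuity *)

Lemma continuous_lin {R : realType} {T : topologicalType} {h k : T -> R[i]}
    (a b : R[i]) :
  continuous h -> continuous k -> continuous (fun x => a * h x + b * k x).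
Proof.
move=> hc kc x.
exact: (@cvg_lin R[i] _ _ (nbhs_filter x) h k (h x) (k x) a b (hc x) (kc x)).
Qed.

Lemma continuous_basis {R : realType} {T : topologicalType}
    {f g p q : T -> R[i]} {a b c d : R[i]} : a * d - b * c != 0 ->
    f = (fun x => a * p x + b * q x) -> g = (fun x => c * p x + d * q x) ->
  continuous f -> continuous g -> continuous p /\ continuous q.
Proof.
move=> e0 fE gE fc gc; set e := a * d - b * c in e0; split.
  rewrite (_ : p = (fun x => d / e * f x + - (b / e) * g x)).
    exact: continuous_lin.
  by apply/funext => x; rewrite fE gE /e; field.
rewrite (_ : q = (fun x => - (c / e) * f x + a / e * g x)).
  exact: continuous_lin.
by apply/funext => x; rewrite fE gE /e; field.
Qed.

(** * The classification *)

Theorem theorem3p6 (R : realType) :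
  (forall (S : semigroupType) (sigma : S -> S) (mu : discrete_measure R S),
     involutive_automorphism sigma ->
     forall f g : S -> R[i],
       kannappan_sine_subtraction sigma mu f g <->
       (solution1 f g \/
        solution2 mu f g \/
        (exists chi : S -> R[i], solution3 sigma mu f g chi) \/
        (exists chi : S -> R[i], solution4 sigma mu f g chi) \/
        (exists chi : S -> R[i], solution5 sigma mu f g chi) \/
        (exists chi phi : S -> R[i], solution6 sigma mu f g chi phi) \/
        (exists chi phi : S -> R[i], solution7 sigma mu f g chi phi) \/
        (exists chi phi : S -> R[i], solution8 sigma mu f g chi phi))) /\
  (forall (S : topologicalSemigroupType) (sigma : S -> S)
          (mu : discrete_measure R S),
     involutive_automorphism sigma ->
     forall f g : S -> R[i], continuous f -> continuous g ->
       (forall chi : S -> R[i],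
          solution3 sigma mu f g chi \/ solution4 sigma mu f g chi \/
          solution5 sigma mu f g chi ->
          continuous chi /\ continuous (chi \o sigma)) /\
       (forall chi phi : S -> R[i],
          solution6 sigma mu f g chi phi \/ solution7 sigma mu f g chi phi \/
          solution8 sigma mu f g chi phi ->
          [/\ continuous chi, continuous (chi \o sigma) & continuous phi])).
Proof.
split=> [S sigma mu si f g|S sigma mu si f g fc gc]; last first.
  split=> [chi /exponential_formP|chi phi /solution_sine_form].
    move=> [a [b [c [d [[_ _ e0] [_ [fE gE]]]]]]].
    exact: (continuous_basis e0 fE gE fc gc).
  move=> [a [b [c [d [[_ e0] [_ [[cs _ _ _] [fE gE]]]]]]]].
  have [cc cp] := continuous_basis e0 fE gE fc gc.
  by rewrite cs; exact: (And3 cc cc cp).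
have [sM sK] := si.
split=> [K|].
  have [f0|f0] := pselect (f = (fun=> 0)); first by left.
  have [fr|nf] := pselect (free2 f g); last first.
    have [k gE] := not_free2 nf f0.
    right; left; split; [exact: f0| |by exists k].
    move=> x y; apply: (is_dint_eq (K x (sigma y))) => [t|].
      by rewrite sK.
    by rewrite gE; ring.
  have [[chi /exponential_formP [s3|[s4|s5]]]|] := kannappan_free2 si K fr.
  - by do 2!right; left; exists chi.
  - by do 3!right; left; exists chi.
  - by do 4!right; left; exists chi.
  move=> [chi [phi /sine_form_solution [psi [s6|s7]]]].
  - by do 5!right; left; exists chi, psi.
  - by do 6!right; left; exists chi, psi.
case=> [f0|[[_ f0 [k gE]]|H]].
- move=> x y; rewrite f0 /= !mul0r subrr; exact: is_dint0.
- move=> x y; apply: (is_dint_eq (f0 x (sigma y))) => //.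
  by rewrite gE; ring.
have [[chi]|[chi [phi]]] : (exists chi, exponential_form sigma mu f g chi) \/
    exists chi phi, sine_form sigma mu f g chi phi.
  case: H => [[chi s]|[[chi s]|[[chi s]|H]]];
    [left; exists chi; apply/exponential_formP; tauto ..|].
  case: H => [[chi [phi s]]|[[chi [phi s]]|[chi [phi s]]]];
    right; exists chi, phi; apply: solution_sine_form; tauto.
- exact: exponential_form_kannappan.
- exact: sine_form_kannappan.
Qed.
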